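(* Let $X$ be a compact metric space with metric $d$. If a continuous map $f\colon X\to X$ is h-expansive and has the shadowing property, then the set of periodic points $Per(f)=\bigcup_{j\ge1}\{x\in X\colon f^j(x)=x\}$ is either empty or zero-dimensional.
   Context: Let $X$ be a compact metric space with metric $d$ and let $f\colon X\to X$ be a continuous map. Shadowing: for $\delta>0$, a sequence $(x_i)_{i\ge0}$ of points of $X$ is a $\delta$-pseudo orbit of $f$ if $d(f(x_i),x_{i+1})\le\delta$ for all $i\ge0$. For $\epsilon>0$, it is $\epsilon$-shadowed by $x\in X$ if $d(f^i(x),x_i)\le\epsilon$ for all $i\ge0$. The map $f$ has the shadowing property if for any $\epsilon>0$ there is $\delta>0$ such that every $\delta$-pseudo orbit of $f$ is $\epsilon$-shadowed by some point of $X$. h-expansiveness: for $K\subset X$, $n\ge1$ and $r>0$, a subset $E\subset K$ is $(n,r)$-separated if $\max_{0\le i\le n-1}d(f^i(x),f^i(y))>r$ for all $x,y\in E$ with $x\ne y$. Let $s_n(f,K,r)$ be the largest cardinality of an $(n,r)$-separated subset of $K$, let $h(f,K,r)=\limsup_{n\to\infty}\frac1n\log s_n(f,K,r)$, and let $h(f,K)=\lim_{r\to0}h(f,K,r)$. For $x\in X$ and $\epsilon>0$ let $\Phi_\epsilon(x)=\{y\in X\colon d(f^i(x),f^i(y))\le\epsilon\text{ for all }i\ge0\}$, and let $h_f^\ast(\epsilon)=\sup_{x\in X}h(f,\Phi_\epsilon(x))$. The map $f$ is h-expansive if $h_f^\ast(\epsilon)=0$ for some $\epsilon>0$. Zero-dimensionality: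 a subset $S$ of $X$ is zero-dimensional if it is non-empty and for any $x\in S$ and any open subset $U$ of $S$ (in the subspace topology) with $x\in U$, there is a clopen subset $V$ of $S$ such that $x\in V\subset U$. *)

(* Defs.v *)
From HB Require Import structures.
From mathcomp Require Import all_boot all_order all_algebra.
From mathcomp Require Import all_classical all_reals all_analysis.

Set Implicit Arguments.
Unset Strict Implicit.
Unset Printing Implicit Defensive.

Import Order.TTheory GRing.Theory Num.Theory.
Import numFieldNormedType.Exports.

Local Open Scope classical_set_scope.
Local Open Scope ring_scope.

Section Shadowing.
Context {R : realType} {X : metricType R}.
Implicit Type f : X -> X.

Definition pseudo_orbit f (delta : R) (u : nat -> X) : Prop :=
  forall i, mdist (f (u i)) (u i.+1) <= delta.

Definition shadowed_by f (eps : R) (u : nat -> X) (x : X) : Prop :=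
  forall i, mdist (iter i f x) (u i) <= eps.

Definition shadowing_property f : Prop :=
  forall eps : R, 0 < eps -> exists2 delta : R, 0 < delta &
    forall u, pseudo_orbit f delta u -> exists x, shadowed_by f eps u x.

End Shadowing.

Section Entropy.
Context {R : realType} {X : metricType R}.
Implicit Types (f : X -> X) (K E : set X).

(* The neutral element 0 of the big maximum is harmless for 1 <= n, distances
   being nonnegative; the value at n = 0 does not affect the entropy below. *)
Definition separated_set f (n : nat) (r : R) E : Prop :=
  forall x y, E x -> E y -> x <> y ->
    \big[Num.max/0]_(i < n) mdist (iter i f x) (iter i f y) > r.

(* Taken in \bar R with [counting] (+oo on infinite sets); it is a maximum, and
   finite, when X is compact, the map is continuous and 0 < r. *)
Definition max_separated f K (n : nat) (r : R) : \bar R :=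
  ereal_sup [set counting E | E in [set E | E `<=` K /\ separated_set f n r E]].

Definition entropy_scale f K (r : R) : \bar R :=
  limn_esup (fun n => (n%:R^-1)%:E * lne (max_separated f K n r))%E.

Definition entropy f K : \bar R := lim (entropy_scale f K r @[r --> 0^'+]).

Definition Phi f (eps : R) (x : X) : set X :=
  [set y | forall i, mdist (iter i f x) (iter i f y) <= eps].

Definition hstar f (eps : R) : \bar R :=
  ereal_sup [set entropy f (Phi f eps x) | x in [set: X]].

Definition h_expansive f : Prop :=
  exists2 eps : R, 0 < eps & hstar f eps = 0%E.

End Entropy.

Definition Per {X : Type} (f : X -> X) : set X :=
  \bigcup_(j in [set j | (1 <= j)%N]) [set x | iter j f x = x].

(* [set_type S], the subtype of points of S, carries the subspace topology; it
   is [S] coerced to a type below. *)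
Definition zero_dimensional_set {X : topologicalType} (S : set X) : Prop :=
  S !=set0 /\
  forall (x : S) (U : set S), open U -> U x ->
    exists V : set S, [/\ clopen V, V x & V `<=` U].

(* Main.v *)
Require Import Defs.
From mathcomp Require Import all_boot all_order all_algebra.
From mathcomp Require Import all_classical all_reals all_analysis.
From mathcomp Require Import finmap zify lra.

(* Fix j >= 1, let F be the closed set of fixed points of f^j, and let p be in
   F. If for every delta some delta-chain in F led from p to a point q at
   distance at least eta, cut it at its first exit from the eta-ball.
   Following a point of F during j steps and then moving along the chain is
   a pseudo orbit, so at each turn one may choose between going p -> q -> p
   and staying at p. All these pseudo orbits remain close to the orbit of p,
   and the points shadowing them form a horseshoe in Phi_eps(p), which gives
   it positive entropy and contradicts h-expansiveness. So delta-chain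
   components of F are small for small delta, and disjoint closed sets can
   be separated by a closed partition of F. Since Per(f) is the union over j
   of these sets, the argument of the countable sum theorem of dimension
   theory (enlarge two open sets with disjoint closures by absorbing one F
   after the other, using normality) yields disjoint open sets that cover
   Per(f) and separate a given periodic point from a given closed set. *)

Import Order.TTheory GRing.Theory Num.Theory.
Import numFieldNormedType.Exports.

Local Open Scope classical_set_scope.
Local Open Scope ring_scope.

(** * Lower bounds for entropy *)

Section Entropy.
Context {R : realType} {X : metricType R}.
Implicit Types (f : X -> X) (K : set X).

Lemma max_separated_ge0 f K n (r : R) : (0 <= max_separated f K n r)%E.
Proof.
apply: ereal_sup_ubound; exists set0; last first.
  by rewrite /counting asboolT// fset_set0.
by split=> // x y.
Qed.

Lemma le_max_separated f K n (r s : R) :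
  r <= s -> (max_separated f K n s <= max_separated f K n r)%E.
Proof.
move=> rs; apply: ereal_sup_le => _ [E [EK sepE] <-]; exists E => //.
by split=> // x y Ex Ey xy; apply: le_lt_trans rs (sepE x y Ex Ey xy).
Qed.

Lemma le_entropy_scale f K (r s : R) :
  r <= s -> (entropy_scale f K s <= entropy_scale f K r)%E.
Proof.
move=> rs; apply: le_ereal_inf_tmp => _ [V Voo <-].
apply: le_trans (_ : (ereal_sup ((fun n => (n%:R^-1)%:E
  * lne (max_separated f K n s)) @` V) <= _)%E).
  by apply: ereal_inf_lbound; exists V.
apply: ge_ereal_sup => _ [n Vn <-].
apply: le_trans (_ : ((n%:R^-1)%:E * lne (max_separated f K n r) <= _)%E).
  apply: lee_wpmul2l; first by rewrite lee_fin invr_ge0 ler0n.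
  rewrite lee_lne ?in_itv/= ?leey ?max_separated_ge0//.
  exact: le_max_separated.
by apply: ereal_sup_ubound; exists n.
Qed.

(** Entropy at scale [r] grows as [r] decreases, so the limit at 0 exists and dominates every scale;
    positivity need only be shown at one scale. *)
Lemma entropy_scale_le_entropy f K (r : R) :
  0 < r -> (entropy_scale f K r <= entropy f K)%E.
Proof.
move=> r0; apply: lime_ge.
  apply: nonincreasing_at_right_is_cvge; apply: nearW => t x y _ _.
  exact: le_entropy_scale.
near=> t; apply: le_entropy_scale; near: t; exact: nbhs_right_le.
Unshelve. all: by end_near. Qed.

Lemma entropy_scale_gt0 f K (r : R) T : (0 < T)%N ->
  (forall n, ((2 ^ (n %/ T))%:R%:E <= max_separated f K n r)%E) ->
  (0 < entropy_scale f K r)%E.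
Proof.
move=> T0 sepn.
have ln20 : 0 < ln 2 :> R by rewrite ln_gt0 ?ltr1n.
apply: (@lt_le_trans _ _ ((ln 2 / (2 * T%:R))%:E)).
  by rewrite lte_fin divr_gt0// mulr_gt0// ltr0n.
apply: le_ereal_inf_tmp => _ [V [N _ NV] <-].
(* This index lies in [V] and is at least [T], so [n %/ T] is positive and hence at least
   [n / (2 * T)]; this is the 2 in the bound [ln 2 / (2 * T)]. *)
pose n := (N + T)%N.
apply: le_trans (_ : ((n%:R^-1)%:E * lne (max_separated f K n r) <= _)%E); last first.
  by apply: ereal_sup_ubound; exists n => //; apply: NV; rewrite /= /n leq_addr.
have n0 : (0 < n)%N by rewrite /n; lia.
apply: le_trans (_ : (_ <= (n%:R^-1)%:E * lne (2 ^ (n %/ T))%:R%:E)%E) _; last first.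
  apply: lee_wpmul2l; first by rewrite lee_fin invr_ge0 ler0n.
  by rewrite lee_lne ?in_itv/= ?leey ?max_separated_ge0 ?lee_fin ?ler0n.
rewrite lne_EFin ?ltr0n ?expn_gt0// -EFinM lee_fin natrX lnXn//.
rewrite -[ln 2 *+ _]mulr_natr [leRHS]mulrC -!mulrA ler_pM2l//.
rewrite ler_pdivlMr ?ltr0n// mulrC ler_pdivrMr ?mulr_gt0 ?ltr0n//.
rewrite -!natrM ler_nat.
have := divn_eq n T; have := ltn_pmod n T0.
have : (0 < n %/ T)%N by rewrite divn_gt0// /n leq_addl.
nia.
Qed.

End Entropy.

(** * Horseshoes from loops of fixed points of an iterate *)

Section Horseshoe.
Context {R : realType} {X : metricType R}.
Implicit Types (f : X -> X) (K : set X).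

Lemma card_le_max_separated f K n (r : R) (I : finType) (x : I -> X) :
  0 <= r -> (forall i, K (x i)) ->
  (forall i i', i != i' ->
    exists2 t, (t < n)%N & r < mdist (iter t f (x i)) (iter t f (x i'))) ->
  (#|I|%:R%:E <= max_separated f K n r)%E.
Proof.
move=> r0 Kx sepx.
have xinj : injective x.
  move=> i i' xii'; apply/eqP/negPn/negP => /sepx[t _].
  by rewrite xii' mdistxx ltNge r0.
apply: ereal_sup_ubound; exists (range x).
  split=> [_ [i _ <-]//|_ _ [i _ <-] [i' _ <-] xii'].
  have /sepx[t tn rt] : i != i' by apply/eqP => ii'; apply: xii'; rewrite ii'.
  apply: lt_le_trans rt _.
  by rewrite (bigD1 (Ordinal tn))//= le_max lexx.
rewrite /counting asboolT; last exact: finite_image finite_finset.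
rewrite (fset_set_image _ finite_finset) card_imfset//=.
congr (_%:R%:E); rewrite cardE; apply/perm_size/uniq_perm.
- exact: fset_uniq.
- exact: enum_uniq.
move=> i; rewrite mem_enum in_fset_set ?in_setT ?inE//; exact: finite_finset.
Qed.

Lemma modn_succ d m : (0 < d)%N -> (d %| m.+1)%N -> (m %% d).+1 = d.
Proof.
move=> d0; rewrite {1}(divn_eq m d) -addnS dvdn_addr ?dvdn_mull// => dm.
by apply/eqP; rewrite eqn_leq ltn_pmod//= dvdn_leq.
Qed.

Lemma iter_modn f j (x : X) t : iter j f x = x -> iter t f x = iter (t %% j) f x.
Proof.
move=> xj; rewrite {1}(divn_eq t j) addnC iterD; congr (iter _ f _).
by elim: (t %/ j)%N => //= q IHq; rewrite mulSn iterD IHq.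
Qed.

(** Jumps occur only at multiples of [j]; there the true orbit is back at [v s], so the error is the
    distance from [v s] to [v s.+1]. *)
Lemma pseudo_orbit_periodic f j (delta : R) (v : nat -> X) :
  (0 < j)%N -> 0 <= delta -> (forall s, iter j f (v s) = v s) ->
  (forall s, mdist (v s) (v s.+1) <= delta) ->
  pseudo_orbit f delta (fun t => iter (t %% j) f (v (t %/ j)%N)).
Proof.
move=> j0 d0 vj vd t /=; rewrite divnS// modnS.
case: ifPn => [jt|_]; last by rewrite add0n /= mdistxx.
rewrite add1n/= -[f _]/(iter (t %% j).+1 f _).
by rewrite modn_succ// vj.
Qed.

Definition loop_word (p : X) (l : nat -> X) (L : nat) (w : nat -> bool) s : X :=
  if w (s %/ L)%N then l (s %% L)%N else p.

(** Both kinds of block start and end at [p], so they can be joined in any order. *)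
Lemma loop_word_step (p : X) l L w (delta : R) : (0 < L)%N ->
  l 0%N = p -> l L = p -> (forall s, mdist (l s) (l s.+1) <= delta) ->
  forall s, mdist (loop_word p l L w s) (loop_word p l L w s.+1) <= delta.
Proof.
move=> L0 l0 lL ld s; rewrite /loop_word divnS// modnS.
have d0 : mdist p p <= delta by rewrite mdistxx (le_trans _ (ld 0%N)) ?mdist_ge0.
case: (boolP (L %| s.+1)%N) => [Ls|_]; last by rewrite add0n; case: ifP.
rewrite l0 if_same; case: ifP => // _.
by have := ld (s %% L)%N; rewrite modn_succ// lL.
Qed.

(** Each binary word of length [n %/ (L * j)] yields a pseudo orbit near the orbit of [p], and its
    shadowing point lies in [Phi f eps p]. Where two words differ, one pseudo orbit visits [l m]
    while the other waits at [p]; passing to the shadowing points costs at most [2 * e]. *)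
Lemma horseshoe f j (p : X) (l : nat -> X) L m (delta e r eps : R) :
  (0 < j)%N -> (m < L)%N -> (forall s, iter j f (l s) = l s) ->
  l 0%N = p -> l L = p -> (forall s, mdist (l s) (l s.+1) <= delta) ->
  (forall s i, (i < j)%N -> mdist (iter i f p) (iter i f (l s)) <= eps / 2) ->
  (forall u, pseudo_orbit f delta u -> exists x, shadowed_by f e u x) ->
  e <= eps / 2 -> 0 <= r -> r + 2 * e < mdist p (l m) ->
  forall n, ((2 ^ (n %/ (L * j)))%:R%:E <= max_separated f (Phi f eps p) n r)%E.
Proof.
move=> j0 mL lj l0 lL ld lclose shadow eeps r0 rm n.
have L0 : (0 < L)%N by apply: leq_ltn_trans mL.
have pj : iter j f p = p by rewrite -l0 lj.
set k := (n %/ (L * j))%N.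
(* After its [k] letters a word continues with [false], that is, the pseudo orbit stays on the orbit
   of [p]. *)
pose word (w : {ffun 'I_k -> bool}) b := odflt false (omap w (insub b)).
pose v w := loop_word p l L (word w).
have vj w s : iter j f (v w s) = v w s.
  by rewrite /v /loop_word; case: ifP.
pose u w t := iter (t %% j) f (v w (t %/ j)%N).
have /choice[x xu] w : exists x, shadowed_by f e (u w) x.
  apply: shadow; apply: pseudo_orbit_periodic => //.
    by apply: le_trans (ld 0%N); exact: mdist_ge0.
  exact: loop_word_step.
have := @card_le_max_separated f (Phi f eps p) n r {ffun 'I_k -> bool} x r0.
rewrite card_ffun card_bool card_ord; apply.
- move=> w t; apply: le_trans (metric_triangle _ (u w t) _) _.
  rewrite [leRHS]splitr lerD//; last by rewrite metric_sym (le_trans (xu w t)).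
  rewrite (@iter_modn f j p t pj) /u /v /loop_word; have tj := ltn_pmod t j0.
  by case: ifP => _; [exact: lclose|rewrite -{2}l0 lclose].
move=> w w' ww'.
have [b wb] : exists b : 'I_k, w b != w' b.
  by apply/existsP; apply: contraNT ww'; rewrite negb_exists => /forallP ww';
    apply/eqP/ffunP => b; apply/eqP; rewrite -[_ == _]negbK.
(* In block [b] this is the moment when the loop is at [l m]; being a multiple of [j], it applies no
   further iterate of [f]. *)
exists ((b * L + m) * j)%N.
  have : (k * (L * j) <= n)%N by rewrite leq_trunc_div.
  have := ltn_ord b; nia.
set t := (_ * j)%N.
have tj : (t %% j = 0)%N by rewrite modnMl.
have uE w1 : u w1 t = if w1 b then l m else p.
  rewrite /u tj /t mulnK// /v /loop_word divnMDl// (divn_small mL) addn0.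
  by rewrite modnMDl modn_small// /word insubT//= => ?; congr (if w1 _ then _ else _);
    apply: val_inj.
have uu : mdist (u w t) (u w' t) = mdist p (l m).
  by rewrite !uE; move: wb; case: (w b); case: (w' b) => //= _; rewrite metric_sym.
have := xu w t; have := xu w' t.
have := metric_triangle (u w t) (iter t f (x w)) (u w' t).
have := metric_triangle (iter t f (x w)) (iter t f (x w')) (u w' t).
rewrite uu (metric_sym (u w t)) => *; lra.
Qed.

End Horseshoe.

(** The index [minn s (m.*2 - s)] climbs from 0 to [m], descends to 0 at [m.*2], and then stays at 0
    by truncated subtraction. It turns a chain into a loop. *)
Lemma tent_le m s : (minn s (m.*2 - s) <= m)%N.
Proof. lia. Qed.

Lemma tent_step m s : let t s := minn s (m.*2 - s) in
  [\/ t s.+1 = (t s).+1, t s = (t s.+1).+1 | t s = t s.+1].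
Proof.
move=> t; rewrite /t; have [sm|ms] := ltnP s m; first by apply: Or31; lia.
by have [sm|ms'] := ltnP s m.*2; [apply: Or32|apply: Or33]; lia.
Qed.

(** * Chains of fixed points and their smallness *)

Section Chains.
Context {R : realType} {X : metricType R}.
Implicit Types (f : X -> X) (F : set X).

Lemma nbhs_mdistP (x : X) (A : set X) :
  nbhs x A <-> exists2 e : R, 0 < e & forall y, mdist x y < e -> A y.
Proof.
split=> [/nbhs_ballP|] [e e0 xA]; last apply/nbhs_ballP; exists e => // y.
  by have := xA y; rewrite ballEmdist.
by rewrite ballEmdist; exact: xA.
Qed.

Lemma near_mdist (y : X) (e : R) : 0 < e -> \forall x \near y, mdist y x < e.
Proof. by move=> e0; apply/nbhs_mdistP; exists e. Qed.

Lemma continuous_iter f n : continuous f -> continuous (iter n f).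
Proof.
move=> fc; elim: n => [|n IHn] x; first exact: cvg_id.
exact: continuous_comp (IHn x) (fc _).
Qed.

Lemma near_mdist_iter f n (y : X) (e : R) : continuous f -> 0 < e ->
  \forall x \near y, mdist (iter n f y) (iter n f x) < e.
Proof.
move=> fc e0.
exact: (continuous_iter f n fc y _ (near_mdist _ _ e0)).
Qed.

Lemma closed_fixed f j : continuous f -> closed [set x | iter j f x = x].
Proof.
move=> fc y clFy /=; apply/eqP/negPn/negP; rewrite -mdist_gt0 => d0.
have d20 : 0 < mdist (iter j f y) y / 2 by rewrite divr_gt0.
have near1 := near_mdist_iter f j y _ fc d20; have near2 := near_mdist y _ d20.
have [x [/= xF []]] := clFy _ (filterI near1 near2).
rewrite /= xF => d1 d2; rewrite (metric_sym y x) in d2.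
by have := metric_triangle (iter j f y) x y; lra.
Qed.

Definition chain F (delta : R) (x y : X) : Prop :=
  exists m (c : nat -> X), [/\ c 0%N = x, c m = y,
    forall i, (i <= m)%N -> F (c i) &
    forall i, (i < m)%N -> mdist (c i) (c i.+1) <= delta].

Lemma chain_refl F (delta : R) x : F x -> chain F delta x x.
Proof. by move=> Fx; exists 0%N, (fun=> x). Qed.

Lemma chain_mem F (delta : R) x y : chain F delta x y -> F x /\ F y.
Proof. by move=> [m [c [<- <- Fc _]]]; split; apply: Fc. Qed.

Lemma chain_rcons F (delta : R) x y z :
  chain F delta x y -> F z -> mdist y z <= delta -> chain F delta x z.
Proof.
move=> [m [c [c0 cm Fc dc]]] Fz yz.
exists m.+1, (fun i => if (i <= m)%N then c i else z); split=> //.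
- by rewrite ltnn.
- by move=> i _; case: ifP => // im; apply: Fc.
move=> i; rewrite ltnS => im; rewrite im; case: ltngtP im => // [im|->] _.
  exact: dc.
by rewrite cm.
Qed.

Lemma chain_cons F (delta delta' : R) x y z : delta <= delta' ->
  F x -> mdist x y <= delta' -> chain F delta y z -> chain F delta' x z.
Proof.
move=> dd' Fx xy [m [c [c0 cm Fc dc]]].
exists m.+1, (fun i => if i is i'.+1 then c i' else x); split=> //.
- by move=> [//|i]; rewrite ltnS; exact: Fc.
- by move=> [_|i im]; rewrite ?c0//; apply: le_trans dd'; exact: dc.
Qed.

Lemma h_expansive_chain_small f j (p : X) (eta : R) : continuous f ->
  h_expansive f -> shadowing_property f -> (0 < j)%N -> iter j f p = p ->
  0 < eta -> exists2 delta : R, 0 < delta &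
    forall y, chain [set x | iter j f x = x] delta p y -> mdist p y < eta.
Proof.
move=> fc [eps eps0 hstar0] fshadow j0 pj eta0.
have : \forall x \near p, forall i : 'I_j,
    mdist (iter i f p) (iter i f x) <= eps / 2.
  apply: filter_forall => i.
  have : \forall x \near p, mdist (iter i f p) (iter i f x) < eps / 2.
    by apply: near_mdist_iter; rewrite ?divr_gt0.
  by apply: filterS => x /ltW.
move=> /nbhs_mdistP[rho rho0 rhoP].
(* The bound [rho / 2] leaves room for the step that exits the ball of radius [eta']: its length is
   at most [eta' / 2], so the chain remains within [rho] of [p]. *)
pose eta' := Num.min eta (rho / 2).
have eta'0 : 0 < eta' by rewrite lt_min eta0 divr_gt0.
have eta'_eta : eta' <= eta by rewrite ge_min lexx.
have eta'_rho : eta' <= rho / 2 by rewrite ge_min lexx orbT.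
(* With separation scale [r = eta' / 4], the sum [r + 2 * e] is at most three quarters of [eta'],
   less than the exit distance. *)
pose e := Num.min (eps / 2) (eta' / 4).
have e0 : 0 < e by rewrite lt_min !divr_gt0.
have e_eps : e <= eps / 2 by rewrite ge_min lexx.
have e_eta : e <= eta' / 4 by rewrite ge_min lexx orbT.
have [delta0 delta00 shadow] := fshadow e e0.
exists (Num.min delta0 (eta' / 2)); first by rewrite lt_min delta00 divr_gt0.
move=> y [m0 [c [c0 cm Fc dc]]]; rewrite ltNge; apply/negP => etay.
have exm : exists m, (m <= m0)%N && (eta' <= mdist p (c m)).
  by exists m0; rewrite leqnn cm (le_trans eta'_eta).
case: (ex_minnP exm) => m /andP[mm0 etam] mmin.
have m1 : (0 < m)%N.
  by case: m etam {mm0 mmin} => // +; rewrite c0 mdistxx leNgt eta'0.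
have dlt i : (i < m)%N -> mdist (c i) (c i.+1) <= delta0.
  move=> im; have := dc i (leq_trans im mm0).
  by rewrite le_min => /andP[].
have clt i : (i < m)%N -> mdist p (c i) < eta'.
  move=> im; rewrite ltNge; apply/negP => etai.
  have := mmin i; rewrite etai (leq_trans (ltnW im) mm0) => /(_ isT).
  by rewrite leqNgt im.
have cle i : (i <= m)%N -> mdist p (c i) < rho.
  rewrite leq_eqVlt => /predU1P[->|/clt]; last lra.
  have m1m : (m.-1 < m)%N by rewrite prednK.
  have := dc m.-1 (leq_trans m1m mm0); rewrite prednK// le_min => /andP[_].
  have := clt _ m1m; have := metric_triangle p (c m.-1) (c m); lra.
pose l s := c (minn s (m.*2 - s)).
have lstep s : mdist (l s) (l s.+1) <= delta0.
  have := tent_le m s; have := tent_le m s.+1.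
  rewrite /l; case: (tent_step m s) => -> => [im _|_ im|_ _].
  - exact: dlt.
  - by rewrite metric_sym; exact: dlt.
  - by rewrite mdistxx ltW.
have sepn : forall n, ((2 ^ (n %/ (m.*2 * j)))%:R%:E <=
    max_separated f (Phi f eps p) n (eta' / 4))%E.
  apply: (@horseshoe _ _ f j p l m.*2 m delta0 e) => //.
  - by rewrite -addnn -{1}[m]addn0 ltn_add2l.
  - by move=> s; apply/Fc/(leq_trans (tent_le m s)).
  - by rewrite /l min0n.
  - by rewrite /l subnn minn0.
  - move=> s i ij; apply: (rhoP _ _ (Ordinal ij)); exact/cle/tent_le.
  - by rewrite divr_ge0// ltW.
  - rewrite /l -addnn addnK minnn; lra.
have : (0 < hstar f eps)%E.
  apply: lt_le_trans (entropy_scale_gt0 _ _ _ _ _ sepn) _.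
    by rewrite muln_gt0 double_gt0 m1.
  apply: (le_trans (entropy_scale_le_entropy _ _ _ _)); first by rewrite divr_gt0.
  by apply: ereal_sup_ubound; exists p.
by rewrite hstar0 ltxx.
Qed.

End Chains.

(** * Separation of closed sets and the countable sum argument *)

Section Separation.

(** A form of dimension zero suited to the sum argument: [K] and [L] need not lie in [F], and adding
    [A] to [K] and [B] to [L] leaves them closed and disjoint. *)
Definition separates_closed {X : topologicalType} (F : set X) : Prop :=
  forall K L, closed K -> closed L -> K `&` L = set0 ->
  exists A B, [/\ closed A, closed B, F `<=` A `|` B &
    [/\ A `&` B = set0, A `&` L = set0 & K `&` B = set0]].

(** Compactness of [K] gives a single step [d] at which no chain from [K] reaches [L]. The set
    reached from [K] contains every point of [F] within [d] of it, so both it and its complement in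
    [F] are closed. *)
Lemma separates_closed_chain_small {R : realType} {X : metricType R} (F : set X) :
  compact [set: X] -> closed F ->
  (forall p, F p -> forall eta : R, 0 < eta -> exists2 delta : R, 0 < delta &
    forall y, chain F delta p y -> mdist p y < eta) ->
  separates_closed F.
Proof.
move=> cX clF Fsmall K L clK clL KL0.
have cK : compact K by apply: subclosed_compact cX _.
pose P (d : R) x := forall y, chain F d x y -> ~ L y.
have nearP : \forall d \near 0^'+, K `<=` P d.
  apply: (compact_near_coveringP K).1 => // x Kx.
  have [Fx|nFx] := pselect (F x); last first.
    exists (~` F, setT) => /=.
      split; last exact: filterT.
      by apply: open_nbhs_nbhs; split=> //; exact: closed_openC.
    by move=> [x' d] /= [nFx' _] y x'y _; apply: nFx'; case: (chain_mem _ _ _ _ x'y).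
  have : nbhs x (~` L).
    apply: open_nbhs_nbhs; split; first exact: closed_openC.
    by move=> Lx; have : (K `&` L) x by []; rewrite KL0.
  move=> /nbhs_mdistP[eta eta0 xL].
  have [delta delta0 xdelta] := Fsmall x Fx eta eta0.
  (* A [d]-chain from such an [x'] becomes a [delta]-chain from [x] once [x] is put in front. *)
  exists ([set x' | mdist x x' < delta], [set d | d <= delta]) => /=.
    by split; [exact: near_mdist|exact: nbhs_right_le].
  move=> [x' d] /= [xx' dd] y x'y; apply: xL; apply: xdelta.
  exact: chain_cons dd Fx (ltW xx') x'y.
have [d [d0 KP]] := filter_ex (filterI (nbhs_right_gt (0 : R)) nearP).
pose A := [set y | exists2 x, K x & chain F d x y].
have step y z : F y -> F z -> mdist y z <= d -> A y -> A z.
  by move=> Fy Fz yz [x Kx xy]; exists x => //; exact: chain_rcons xy Fz yz.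
exists A, (F `\` A); split.
- move=> y clAy.
  have Fy : F y.
    by apply: clF; apply: closure_subset clAy => z [x _ xz]; case: (chain_mem _ _ _ _ xz).
  have [z [Az zy]] := clAy _ (near_mdist y d d0).
  have [x _ xz] := Az; have [_ Fz] := chain_mem _ _ _ _ xz.
  by apply: step Az => //; rewrite metric_sym ltW.
- move=> y clBy.
  have Fy : F y by apply: clF; apply: closure_subset clBy => z [].
  split=> // Ay; have [z [[Fz nAz] zy]] := clBy _ (near_mdist y d d0).
  by apply: nAz; apply: step Ay => //; rewrite ltW.
- by move=> y Fy; have [Ay|nAy] := pselect (A y); [left|right].
split.
- by rewrite -subset0 => y [Ay []].
- by rewrite -subset0 => y [[x Kx xy] Ly]; exact: KP Kx _ xy Ly.
- rewrite -subset0 => y [Ky [Fy nAy]]; apply: nAy.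
  by exists y => //; exact: chain_refl.
Qed.

Context {X : topologicalType}.
Implicit Types (F K L : set X).

(** Normality is used twice: [closure G] lies in an open [G'] whose closure misses [L], and [H] is
    the complement of [closure G']. As [G'] is open and misses [H], it misses [closure H] too. *)
Lemma normal_open_closure K L : normal_space X -> closed K -> closed L ->
  K `&` L = set0 -> exists G H, [/\ open G, open H, K `<=` G, L `<=` H &
    closure G `&` closure H = set0].
Proof.
move=> nX clK clL KL0.
have enlarge C : closed C -> C `&` L = set0 ->
    exists G, [/\ open G, C `<=` G & closure G `&` L = set0].
  move=> clC CL0; have : set_nbhs C (~` L).
    apply/set_nbhsP; exists (~` L); split=> //; first exact: closed_openC.
    by move=> x Cx Lx; have : (C `&` L) x by []; rewrite CL0.
  move=> /(nX _ clC)[D /set_nbhsP[G [oG CG GD]] DL]; exists G; split=> //.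
  by rewrite -subset0 => x [/(closure_subset GD)/DL].
have [G [oG KG GL0]] := enlarge K clK KL0.
have [G' [oG' GG' GL'0]] := enlarge _ (@closed_closure _ G) GL0.
exists G, (~` closure G'); split=> //.
- by apply: closed_openC; exact: closed_closure.
- by move=> x Lx clGx; have : (closure G' `&` L) x by []; rewrite GL'0.
- rewrite -subset0 => x [/GG' G'x clHx].
  have [y [nGy G'y]] := clHx _ (open_nbhs_nbhs (conj oG' G'x)).
  by apply: nGy; exact: subset_closure.
Qed.

Lemma separates_closed_bigcup (F : nat -> set X) K L : normal_space X ->
  (forall n, separates_closed (F n)) -> closed K -> closed L -> K `&` L = set0 ->
  exists G H, [/\ open G, open H, K `<=` G, L `<=` H &
    G `&` H = set0 /\ \bigcup_n F n `<=` G `|` H].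
Proof.
move=> nX Fsep clK clL KL0.
(* Disjointness of the closures, not just of the open sets, is the invariant that lets the next
   [F n] be split. *)
pose good (s : set X * set X) :=
  [/\ open s.1, open s.2 & closure s.1 `&` closure s.2 = set0].
have step n s : exists s', good s -> [/\ good s',
    s.1 `<=` s'.1, s.2 `<=` s'.2 & F n `<=` s'.1 `|` s'.2].
  have [[oG oH GH0]|] := pselect (good s); last by exists s.
  have [A [B [clA clB FAB [AB0 AL0 KB0]]]] :=
    Fsep n _ _ (@closed_closure _ s.1) (@closed_closure _ s.2) GH0.
  have [||| G' [H' [oG' oH' GG' HH' GH'0]]] :=
    normal_open_closure (closure s.1 `|` A) (closure s.2 `|` B) nX.
  - by apply: closedU => //; exact: closed_closure.
  - by apply: closedU => //; exact: closed_closure.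
  - by rewrite setIUl !setIUr GH0 KB0 AL0 AB0 !setU0.
  exists (G', H') => _; split=> //=.
  - by move=> x /subset_closure ?; apply: GG'; left.
  - by move=> x /subset_closure ?; apply: HH'; left.
  - by move=> x /FAB[Ax|Bx]; [left; apply: GG'; right|right; apply: HH'; right].
have /choice[next nextP] : forall ns : nat * (set X * set X), exists s',
    good ns.2 -> [/\ good s', ns.2.1 `<=` s'.1, ns.2.2 `<=` s'.2 &
    F ns.1 `<=` s'.1 `|` s'.2] by case=> n s; exact: step.
have [G0 [H0 [oG0 oH0 KG0 LH0 GH0]]] := normal_open_closure _ _ nX clK clL KL0.
pose S := fix S n := if n is n'.+1 then next (n', S n') else (G0, H0).
have goodS n : good (S n).
  by elim: n => [|n /(nextP (n, S n))[]].
have S1 m n : (m <= n)%N -> (S m).1 `<=` (S n).1.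
  move=> /subnK <-; elim: (n - m)%N => // k IHk.
  have [_ sub _ _] := nextP ((k + m)%N, S (k + m)%N) (goodS _).
  exact: subset_trans IHk sub.
have S2 m n : (m <= n)%N -> (S m).2 `<=` (S n).2.
  move=> /subnK <-; elim: (n - m)%N => // k IHk.
  have [_ _ sub _] := nextP ((k + m)%N, S (k + m)%N) (goodS _).
  exact: subset_trans IHk sub.
exists (\bigcup_n (S n).1), (\bigcup_n (S n).2); split.
- by apply: bigcup_open => n _; have [] := goodS n.
- by apply: bigcup_open => n _; have [] := goodS n.
- by move=> x /KG0 ?; exists 0%N.
- by move=> x /LH0 ?; exists 0%N.
split.
(* The stages increase, so a common point would already lie in both sets at stage [maxn m n]. *)
- rewrite -subset0 => x [[m _ Gx] [n _ Hx]].
  have [_ _ <-] := goodS (maxn m n); split; apply: subset_closure.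
    by apply: S1 Gx; exact: leq_maxl.
  by apply: S2 Hx; exact: leq_maxr.
- move=> x [n _ Fx]; have [_ _ _ /(_ x Fx)] := nextP (n, S n) (goodS n).
  by case=> ?; [left|right]; exists n.+1.
Qed.

End Separation.

(** * Clopen neighbourhoods in the set of periodic points *)

Theorem theorem1p2 (R : realType) (X : metricType R) (f : X -> X)
  (Xcompact : compact [set: X]) (fcont : continuous f)
  (fhexp : h_expansive f) (fshadow : shadowing_property f) :
  Per f = set0 \/ zero_dimensional_set (Per f).
Proof.
have [|/set0P Perf] := eqVneq (Per f) set0; [by left|right; split=> //].
move=> x U [W oW <-{U}] /= Wx.
pose F n := [set y | iter n.+1 f y = y].
have Fsep n : separates_closed (F n).
  apply: separates_closed_chain_small => //; first exact: closed_fixed.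
  by move=> p Fp eta; exact: h_expansive_chain_small.
have nX : normal_space X by apply: compact_normal => //; exact: metric_hausdorff.
have xW0 : [set set_val x] `&` ~` W = set0 by rewrite -subset0 => _ [->].
have clx : closed [set set_val x].
  exact/accessible_closed_set1/hausdorff_accessible/metric_hausdorff.
have [G [H [oG oH xG WH [GH0 FGH]]]] :=
  separates_closed_bigcup F _ _ nX Fsep clx (open_closedC oW) xW0.
exists (set_val @^-1` G); split; last 2 first.
- exact: xG.
- move=> y /= Gy; apply: contrapT => nWy.
  have GHy : (G `&` H) (set_val y) by split=> //; exact: WH.
  by rewrite GH0 in GHy.
split; first by exists G.
(* On [Per f] the disjoint open sets [G] and [H] are complementary, so the trace of [G] is closed as
   well. *)
rewrite (_ : _ @^-1` G = ~` (set_val @^-1` H)).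
  by apply: open_closedC; exists H.
apply/seteqP; split=> y /=.
- by move=> Gy Hy; have : (G `&` H) (set_val y) by []; rewrite GH0.
- have [//|//] : (G `|` H) (set_val y).
  apply: FGH; have [j /= j0 yj] := set_mem (valP y).
  by exists j.-1 => //; rewrite /F prednK.
Qed.
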